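(* Let $J>2$ and $\theta=(\nu,Q,(f_x)_{x\in\mathbb{X}})\in\Theta^{\mathrm{ind}}$. Let $Y$ denote an observation (a random variable distributed as $Y_1$ under $\mathbb{P}_\theta$, i.e. with density $\sum_{l=1}^J\nu_lf_l$). If $$\mathbb{P}_\theta\left(\bigcup_{j=1}^J\left\{0<\max_{l\ne j}\nu_lf_l(Y)<\nu_jf_j(Y)\le\sum_{l\ne j}\nu_lf_l(Y)\right\}\right)>0,$$ then for every $n\ge2$, $$\mathbb{P}_\theta\left(g^\star_\theta(Y_{1:n})\ne\pi_n\circ h^\star_\theta(Y_{1:n})\right)>0.$$
   Context: Model. $J\ge2$ is an integer, $\mathbb{X}=\{1,\dots,J\}$, $(\mathbb{Y},\mathcal{Y})$ is a Polish space with its Borel $\sigma$-field and $\mathcal{L}$ is a dominating ($\sigma$-finite) measure on it. A parameter is $\theta=(\nu,Q,(f_x)_{x\in\mathbb{X}})$ with $\nu$ a probability vector on $\mathbb{X}$, $Q$ a $J\times J$ transition matrix and $f_x$ probability densities with respect to $\mathcal{L}$. Under $\mathbb{P}_\theta$ (expectation $\mathbb{E}_\theta$), $(X_i)_{i\ge1}$ is a Markov chain on $\mathbb{X}$ with initial law $\nu$ and transition matrix $Q$ and, conditionally on $(X_i)_{i\ge 1}$, the $Y_i$ are independent, $Y_i$ having density $f_{X_i}$. $Y_{1:n}=(Y_1,\dots,Y_n)$. $\Theta^{\mathrm{ind}}$ is the set of parameters for which all rows of $Q$ equal $\nu$ (so the $X_i$ are i.i.d. with law $\nu$). Clusterers and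 classifiers. $\mathcal{P}[n]$ is the set of partitions of $[n]=\{1,\dots,n\}$. An $n$-clusterer is a measurable map $g:\mathbb{Y}^n\to\mathcal{P}[n]$; an $n$-classifier is a measurable map $h=(h_1,\dots,h_n):\mathbb{Y}^n\to\mathbb{X}^n$. $\pi_n:\mathbb{X}^n\to\mathcal{P}[n]$ is $\pi_n(x_{1:n})=\{\{i:x_i=x\}:x\in\mathbb{X}\}\setminus\{\varnothing\}$, and $\Pi_n=\pi_n(X_{1:n})$. For partitions $A,B$ of $[n]$, $\ell(A,B)=1-\frac1n\sup_M\sum_{\{C,C'\}\in M}\mathrm{Card}(C\cap C')$, the supremum being over matchings $M$ between the blocks of $A$ and the blocks of $B$ in the complete bipartite graph (each block is in at most one edge). The Bayes clusterer $g^\star_\theta$ is a clusterer minimizing $\mathbb{E}_\theta[\ell(g(Y_{1:n}),\Pi_n)\mid Y_{1:n}]$. The Bayes classifier $h^\star_\theta=(h^\star_{\theta,1},\dots,h^\star_{\theta,n})$ satisfies $\mathbb{P}_\theta(X_i=h^\star_{\theta,i}(Y_{1:n})\mid Y_{1:n})=\max_{x\in\mathbb{X}}\mathbb{P}_\theta(X_i=x\mid Y_{1:n})$ for $i=1,\dots,n$. If minimizers are not unique, $g^\star_\theta$ and $h^\star_\theta$ denote any choices of them. *)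

(* Defs.v *)
From HB Require Import structures.
From mathcomp Require Import all_boot all_order all_algebra.

Set Implicit Arguments.
Unset Strict Implicit.
Unset Printing Implicit Defensive.

Import Order.TTheory GRing.Theory Num.Theory.

Section Partitions.
Variable n : nat.
Local Notation block := {set 'I_n}.

Definition is_partition (A : {set block}) : bool := partition A [set: 'I_n].

Definition pi_n J (x : n.-tuple 'I_J) : {set block} :=
  [set [set i | tnth x i == a] | a : 'I_J] :\ set0.

(* An edge of the complete bipartite graph between the blocks of A and those
   of B is a pair; two edges of M sharing an endpoint are equal. *)
Definition is_matching (A B : {set block}) (M : {set block * block}) : bool :=
  (M \subset setX A B) &&
  [forall e in M, forall e' in M,
     ((e.1 == e'.1) || (e.2 == e'.2)) ==> (e == e')].

Local Open Scope ring_scope.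

Definition loss (R : numFieldType) (A B : {set block}) : R :=
  1 - n%:R^-1 * (\max_(M | is_matching A B M)
                    \sum_(e in M) #|e.1 :&: e.2|)%N%:R.

End Partitions.

From mathcomp Require Import all_classical all_reals all_analysis.
Import numFieldNormedType.Exports.

Local Open Scope classical_set_scope.
Local Open Scope ring_scope.

Definition polish_space (R : realType) (T : topologicalType) : Prop :=
  (exists dist : T -> T -> R,
    [/\ [/\ forall x y, 0 <= dist x y,
            forall x y, dist x y = 0 <-> x = y,
            forall x y, dist x y = dist y x &
            forall x y z, dist x z <= dist x y + dist y z],
        forall (x : T) (A : set T), nbhs x A <->
          exists2 e : R, 0 < e & [set y | dist x y < e] `<=` A &
        forall u : nat -> T,
          (forall e : R, 0 < e -> exists N : nat, forall p q : nat,
             (N <= p)%N -> (N <= q)%N -> dist (u p) (u q) < e) ->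
          exists l : T, u @ \oo --> l])
  /\ (exists2 D : set T, countable D & dense D).

Notation borel T := (g_sigma_algebraType (@open T)).

(* Measurability into a type carrying its discrete sigma-algebra; only used
   for finite F. *)
Definition discrete_measurable_fun d (S : measurableType d) (F : Type)
  (f : S -> F) : Prop := forall a : F, measurable (f @^-1` [set a]).

(* Sequences Z_1, Z_2, ... are indexed from 0, so Z_1, ..., Z_n are Z 0, ..., Z n.-1. *)
Definition prefix_of (Om S : Type) (Z : nat -> Om -> S) (n : nat) (w : Om) :
  n.-tuple S := [tuple Z i w | i < n].

Section ConditionalExpectation.
Context d d' (Om : measurableType d) (S : measurableType d') (R : realType).
Variables (P : probability Om R) (W : Om -> S).

Definition is_cond_exp (U Z : Om -> R) : Prop :=
  [/\ measurable_fun [set: g_sigma_algebra_preimageType W]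
        (Z : g_sigma_algebra_preimageType W -> R),
      P.-integrable [set: Om] (EFin \o Z) &
      forall A : set Om, g_sigma_algebra_preimage W A ->
        (\int[P]_(w in A) (Z w)%:E = \int[P]_(w in A) (U w)%:E)%E].

(* A version of E[U | W]. For integrable U and measurable W a version exists
   and any two versions agree P-almost everywhere, so the choice made by xget
   is irrelevant in statements holding P-almost everywhere. *)
Definition cond_exp (U : Om -> R) : Om -> R :=
  xget (fun=> 0) [set Z | is_cond_exp U Z].

Definition cond_prob (A : set Om) : Om -> R := cond_exp \1_A.

End ConditionalExpectation.

Record hmm_param (R : realType) (J : nat) (T : ptopologicalType) := HmmParam {
  init : 'rV[R]_J ;
  trans : 'M[R]_J ;
  dens : 'I_J -> borel T -> R }.

Section Model.
Context (R : realType) (J : nat) (T : ptopologicalType).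
Variable L : {sigma_finite_measure set (borel T) -> \bar R}.
Implicit Type theta : hmm_param R J T.

Definition prob_vector (p : 'rV[R]_J) : Prop :=
  (forall x, 0 <= p 0 x) /\ \sum_x p 0 x = 1.

Definition prob_density (f : borel T -> R) : Prop :=
  [/\ measurable_fun [set: borel T] f, forall y, 0 <= f y &
      (\int[L]_y (f y)%:E = 1)%E].

Definition is_param theta : Prop :=
  [/\ prob_vector (init theta),
      forall x, prob_vector (row x (trans theta)) &
      forall x, prob_density (dens theta x)].

Definition Theta_ind theta : Prop :=
  is_param theta /\ forall x, row x (trans theta) = init theta.

Context d (Om : measurableType d).
Variables (P : probability Om R) (X : nat -> Om -> 'I_J)
  (Y : nat -> Om -> borel T).

Definition is_markov_chain (nu : 'rV[R]_J) (Q : 'M[R]_J) : Prop :=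
  [/\ forall i, discrete_measurable_fun (X i),
      forall x, (P [set w | X 0 w = x] = (nu 0 x)%:E)%E &
      forall n (x : n.+1.-tuple 'I_J) (a : 'I_J),
        (P [set w | prefix_of X n.+1 w = x /\ X n.+1 w = a] =
         P [set w | prefix_of X n.+1 w = x] * (Q (tnth x ord_max) a)%:E)%E].

(* Conditional law of Y given the whole sequence X: an event on the first m
   observations is obtained by taking B i = setT for m <= i, so conditioning
   on arbitrarily long prefixes of X is covered. *)
Definition is_emission (f : 'I_J -> borel T -> R) : Prop :=
  (forall i, measurable_fun [set: Om] (Y i)) /\
  forall n (x : n.-tuple 'I_J) (B : 'I_n -> set (borel T)),
    (forall i, measurable (B i)) ->
    P [set w | prefix_of X n w = x /\ forall i : 'I_n, B i (Y i w)] =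
    (P [set w | prefix_of X n w = x] *
       (\prod_(i < n) \int[L]_(y in B i) f (tnth x i) y)%R%:E)%E.

Definition is_hmm theta : Prop :=
  is_markov_chain (init theta) (trans theta) /\ is_emission (dens theta).

End Model.

Section Bayes.
Context (R : realType) (J : nat) (T : ptopologicalType).
Context d (Om : measurableType d).
Variables (P : probability Om R) (X : nat -> Om -> 'I_J)
  (Y : nat -> Om -> borel T) (n : nat).

Definition clusterer (g : n.-tuple (borel T) -> {set {set 'I_n}}) : Prop :=
  discrete_measurable_fun g /\ forall y, is_partition (g y).

Definition classifier (h : n.-tuple (borel T) -> n.-tuple 'I_J) : Prop :=
  discrete_measurable_fun h.

Definition cond_risk (g : n.-tuple (borel T) -> {set {set 'I_n}}) : Om -> R :=
  cond_exp P (prefix_of Y n)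
    (fun w => loss R (g (prefix_of Y n w)) (pi_n (prefix_of X n w))).

Definition bayes_clusterer (g : n.-tuple (borel T) -> {set {set 'I_n}}) :
  Prop :=
  clusterer g /\
  forall g', clusterer g' ->
    {ae P, forall w, cond_risk g w <= cond_risk g' w}.

(* Conditional probabilities are nonnegative almost everywhere, so the default
   value 0 does not affect the maximum. *)
Definition bayes_classifier (h : n.-tuple (borel T) -> n.-tuple 'I_J) : Prop :=
  classifier h /\
  forall i : 'I_n,
    {ae P, forall w,
       cond_prob P (prefix_of Y n)
         [set w' | X i w' = tnth (h (prefix_of Y n w')) i] w =
       \big[Num.max/0]_(x < J)
         cond_prob P (prefix_of Y n) [set w' | X i w' = x] w}.

End Bayes.

(* The values nu_l f_l(y) are nonnegative, so the default value 0 does not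
   affect the maximum when J > 1. *)
Definition ambiguous (R : realType) (J : nat) (T : ptopologicalType)
  (theta : hmm_param R J T) (j : 'I_J) : set (borel T) :=
  let w l y := init theta 0 l * dens theta l y in
  [set y | [/\ 0 < \big[Num.max/0]_(l < J | l != j) w l y,
               \big[Num.max/0]_(l < J | l != j) w l y < w j y &
               w j y <= \sum_(l < J | l != j) w l y]].

(* Main.v *)
(* Write w_l = nu_l f_l for the posterior weight of color l.  Some j and a <> j
   satisfy 0 < w_a < w_j <= sum_(l <> j) w_l, with w_l < w_j for all l <> j, on
   a set D of observations of positive probability, and by independence all n
   observations lie in D with positive probability.  There the Bayes classifier
   answers j everywhere, so its partition is the single block {1..n}.  This
   block is strictly beaten by {{1}, {2..n}}: fix the colors of the items other
   than 1.  If their most frequent color c is unique, the split overlaps the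
   truth in at least one more item when X_1 <> c and loses at most one when
   X_1 = c, so its conditional expected gain is at least proportional to
   sum_(l <> c) w_l - w_c >= 0; if c is not unique, the split never loses.
   The gain is strict when the other items all have color a, which has positive
   conditional probability. *)

Require Import Defs.
From HB Require Import structures.
From mathcomp Require Import all_boot all_order all_algebra.
From mathcomp Require Import lra.

Set Implicit Arguments.
Unset Strict Implicit.
Unset Printing Implicit Defensive.

Import Order.TTheory GRing.Theory Num.Theory.

(** * Combinatorics of matched overlaps with a coloring *)

Section Overlap.
Context (n J : nat).
Implicit Types (A B : {set {set 'I_n}}) (x : n.-tuple 'I_J) (a b c : 'I_J).

Definition overlap A B : nat :=
  \max_(M | is_matching A B M) \sum_(e in M) #|e.1 :&: e.2|.

Definition split_off (i : 'I_n) : {set {set 'I_n}} :=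
  [set [set i]; ~: [set i]].

Definition upd x (i : 'I_n) b : n.-tuple 'I_J :=
  [tuple if k == i then b else tnth x k | k < n].

Definition color_class x c : {set 'I_n} := [set k | tnth x k == c].

Lemma tnth_upd x i b k : tnth (upd x i b) k = if k == i then b else tnth x k.
Proof. by rewrite tnth_mktuple. Qed.

Lemma tnth_updi x i b : tnth (upd x i b) i = b.
Proof. by rewrite tnth_upd eqxx. Qed.

Lemma updK x i b : upd (upd x i b) i (tnth x i) = x.
Proof.
by apply: eq_from_tnth => k; rewrite !tnth_upd; case: eqVneq => [->|].
Qed.

Lemma updi x i : upd x i (tnth x i) = x.
Proof.
by apply: eq_from_tnth => k; rewrite tnth_upd; case: eqVneq => [->|].
Qed.

Lemma pi_nP x (C : {set 'I_n}) :
  C \in pi_n x -> exists c, C = color_class x c.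
Proof. by rewrite !inE => /andP[_ /imsetP[c _ ->]]; exists c. Qed.

Lemma color_class_pi_n x c k : tnth x k = c -> color_class x c \in pi_n x.
Proof.
move=> xk; rewrite !inE; apply/andP; split; last by apply/imsetP; exists c.
by apply/set0Pn; exists k; rewrite inE xk.
Qed.

Lemma pi_n_const a : 0 < n -> pi_n [tuple a | _ < n] = [set setT].
Proof.
move=> n0; apply/setP => C; rewrite !inE.
apply/andP/eqP => [[C0 /imsetP[c _ CE]]|->].
  have [k kC] := set0Pn _ C0; move: kC; rewrite CE inE tnth_mktuple => /eqP <-.
  by apply/setP => i; rewrite !inE tnth_mktuple eqxx.
split; first by apply/set0Pn; exists (Ordinal n0).
apply/imsetP; exists a => //.
by apply/setP => i; rewrite !inE tnth_mktuple eqxx.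
Qed.

Lemma split_off_partition (i : 'I_n) : 1 < n -> is_partition (split_off i).
Proof.
move=> n1; rewrite /is_partition /partition; apply/and3P; split.
- by rewrite /split_off /cover bigcup_setU !big_set1 setUCr.
- apply/trivIsetP => A B; rewrite !in_set2 => /orP[] /eqP -> /orP[] /eqP -> /=;
  rewrite ?eqxx// -setI_eq0 ?setICr// setIC setICr//.
- rewrite in_set2 negb_or eq_sym -card_gt0 cards1/= eq_sym -card_gt0.
  by rewrite cardsC1 card_ord -subn1 subn_gt0.
Qed.

(** All edges of a matching share the single block [setT], so there is at most one edge, and it
    counts at most one color class. *)
Lemma overlap_trivial x m : (forall c, #|color_class x c| <= m) ->
  overlap [set setT] (pi_n x) <= m.
Proof.
move=> hm; apply/bigmax_leqP => M /andP[/subsetP sM /forall_inP mM].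
have [-> | [e eM]] := set_0Vmem M; first by rewrite big_set0.
have M1 : M = [set e].
  apply/setP => e'; rewrite inE; apply/idP/eqP => [e'M|->//].
  move/forall_inP : (mM _ e'M) => /(_ _ eM) /implyP ee'.
  apply/eqP/ee'; move: (sM _ eM) (sM _ e'M).
  by rewrite !inE => /andP[/eqP -> _] /andP[/eqP -> _]; rewrite eqxx.
rewrite M1 big_set1; move: (sM _ eM); rewrite !inE => /andP[_ e2].
have /pi_nP[c ->] : e.2 \in pi_n x by rewrite !inE.
by rewrite (leq_trans _ (hm c))// subset_leq_card// subsetIr.
Qed.

Lemma overlap_matching A B M : is_matching A B M ->
  \sum_(e in M) #|e.1 :&: e.2| <= overlap A B.
Proof.
by move=> hM; rewrite /overlap (bigD1 M)//= leq_maxl.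
Qed.

(** Leaving item [i] out makes the count invariant under [upd x i], so one coloring of the other
    items can be compared across all colors of [i]. *)
Definition others x i c : nat := #|~: [set i] :&: color_class x c|.

Lemma others_upd x i b c : others (upd x i b) i c = others x i c.
Proof.
congr #|pred_of_set _|; apply/setP => k; rewrite !inE tnth_upd.
by case: eqVneq.
Qed.

Lemma card_color_class x i c :
  #|color_class x c| = others x i c + (tnth x i == c).
Proof.
rewrite (cardsD1 i) inE addnC; congr (_ + _).
by congr #|pred_of_set _|; apply/setP => k; rewrite !inE.
Qed.

Lemma othersP x i c : 0 < others x i c -> exists2 k, k != i & tnth x k = c.
Proof.
by rewrite card_gt0 => /set0Pn[k]; rewrite !inE => /andP[ki /eqP]; exists k.
Qed.

(** Match the complement of [i] with class [c], which is a block since it is nonempty, and, when [i]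
    has another color, also [[set i]] with the class of [i]. *)
Lemma overlap_split x i c : 0 < others x i c ->
  others x i c + (tnth x i != c) <= overlap (split_off i) (pi_n x).
Proof.
move=> c0; have [k ki xk] := othersP c0.
have cB := color_class_pi_n xk.
have [xi|xi] := eqVneq (tnth x i) c.
  rewrite addn0.
  have /overlap_matching : is_matching (split_off i) (pi_n x)
      [set (~: [set i], color_class x c)].
    apply/andP; split.
      apply/subsetP => e; rewrite inE => /eqP ->.
      by rewrite inE/= cB andbT !inE eqxx orbT.
    apply/forall_inP => e; rewrite inE => /eqP ->.
    by apply/forall_inP => e'; rewrite inE => /eqP ->; rewrite !eqxx.
  by rewrite big_set1.
have iNi : [set i] != ~: [set i].
  by apply/eqP => /setP/(_ i); rewrite !inE eqxx.
have cN : color_class x c != color_class x (tnth x i).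
  by apply/eqP => /setP/(_ i); rewrite !inE eqxx (negbTE xi).
have /overlap_matching : is_matching (split_off i) (pi_n x)
    [set (~: [set i], color_class x c); ([set i], color_class x (tnth x i))].
  apply/andP; split.
    apply/subsetP => e; rewrite in_set2 => /orP[] /eqP ->; rewrite inE/=.
      by rewrite cB andbT !inE eqxx orbT.
    by rewrite (color_class_pi_n (erefl (tnth x i))) !inE eqxx.
  apply/forall_inP => e; rewrite in_set2 => /orP[] /eqP ->;
  apply/forall_inP => e'; rewrite in_set2 => /orP[] /eqP -> /=;
  rewrite ?eqxx// -!pair_eqE/=.
    by rewrite eq_sym (negbTE iNi) (negbTE cN).
  by rewrite (negbTE iNi) eq_sym (negbTE cN).
rewrite big_setU1/=; last by rewrite inE -pair_eqE/= eq_sym (negbTE iNi).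
rewrite big_set1 /=; apply: leq_trans; rewrite leq_add2l.
rewrite card_gt0; apply/set0Pn; exists i; by rewrite !inE eqxx /=.
Qed.

End Overlap.

(** * Gain of isolating one item over keeping a single block *)

Section Gain.
Context (R : realFieldType) (n J : nat).
Implicit Types (x : n.-tuple 'I_J) (a b c : 'I_J).
Local Open Scope ring_scope.

(** This is [n] times the loss saved by the split compared with the one-block partition. *)
Definition gain (i : 'I_n) x : R :=
  (overlap (split_off i) (pi_n x))%:R - (overlap [set setT] (pi_n x))%:R.

(* The cases differ in whether the most frequent color among the items other
   than i is unique. *)
Lemma gain_upd x (i : 'I_n) : (1 < n)%N ->
  ((exists k k', [/\ k != i, k' != i & tnth x k != tnth x k']) /\
    forall b, 0 <= gain i (upd x i b)) \/
  exists a, [/\ (exists2 k, k != i & tnth x k = a),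
    forall b, b != a -> 1 <= gain i (upd x i b) & -1 <= gain i (upd x i a)].
Proof.
move=> n1.
have [k0 k0i] : exists k, k != i.
  pose k0 : 'I_n := Ordinal (ltnW n1); pose k1 : 'I_n := Ordinal n1.
  by have [<-|] := eqVneq k0 i; [exists k1|exists k0].
have [a ma] : {a | forall c, (others x i c <= others x i a)%N}.
  by case: (@arg_maxnP _ (tnth x i) xpredT (others x i)) => // a _ ha;
    exists a => c; exact: ha.
set m := others x i a in ma.
have m0 : (0 < m)%N.
  apply: leq_trans (ma (tnth x k0)); rewrite card_gt0; apply/set0Pn.
  by exists k0; rewrite !inE k0i eqxx.
(* Item [i] adds at most one to a class of at most [m] other items. *)
have V1 b : (overlap [set setT] (pi_n (upd x i b)) <= m.+1)%N.
  apply: overlap_trivial => c; rewrite (card_color_class _ i) others_upd.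
  by rewrite -addn1 leq_add// leq_b1.
have V2 b c : others x i c = m ->
    (m + (b != c) <= overlap (split_off i) (pi_n (upd x i b)))%N.
  move=> cm; have := @overlap_split _ _ (upd x i b) i c.
  by rewrite others_upd tnth_updi cm; exact.
(* Either a second color [a'] ties with [a] for the maximum [m], or [a] is the unique maximizer. *)
have [/existsP[a' /andP[a'a /eqP a'm]]|/existsPn ua] :=
  boolP [exists a', (a' != a) && (others x i a' == m)].
  have [k ki xk] := othersP m0.
  have [k' k'i xk'] : exists2 k', k' != i & tnth x k' = a'.
    by apply: othersP; rewrite a'm.
  left; split; first by exists k', k; rewrite xk xk'.
  move=> b; rewrite subr_ge0 ler_nat (leq_trans (V1 b))// -addn1.
  (* One of the tied colors differs from [b]; matching the large block with that class gives the
     split [m + 1]. *)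
  have [ba|ba] := eqVneq b a.
    by apply: leq_trans (V2 b a' a'm); rewrite ba eq_sym a'a.
  by apply: leq_trans (V2 b a erefl); rewrite ba.
right; exists a; split; first exact: othersP.
- move=> b ba; rewrite lerBrDr -[1]/(1%:R) -natrD ler_nat.
  (* By uniqueness of [a], class [b] has fewer than [m] other items, so even with item [i] no class
     exceeds [m], while the split reaches [m + 1]. *)
  apply: leq_trans (V2 b a erefl); rewrite ba addnC leq_add2r.
  apply: overlap_trivial => c; rewrite (card_color_class _ i) others_upd.
  rewrite tnth_updi; have [<-|_] := eqVneq b c; last by rewrite addn0.
  have := ua b; rewrite ba /= => /negbTE bm.
  by rewrite addn1 ltn_neqAle bm ma.
- rewrite lerBrDr addrC lerBlDr natr1 ler_nat.
  apply: leq_trans (V1 a) _; rewrite ltnS.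
  by apply: leq_trans (V2 a a erefl); rewrite eqxx addn0.
Qed.

(** With a unique majority color [a] the sum is at least the total weight of the colors other than
    [a], minus [w a]; in the tied case every term is nonnegative. *)
Lemma gain_sum_ge0 (w : 'I_J -> R) x (i : 'I_n) : (1 < n)%N ->
  (forall a, 0 <= w a) -> (forall a, w a <= \sum_(b < J | b != a) w b) ->
  0 <= \sum_b gain i (upd x i b) * w b.
Proof.
move=> n1 w0 hw; have [[_ h]|[a [_ hb ha]]] := gain_upd x i n1.
  by apply: sumr_ge0 => b _; rewrite mulr_ge0.
rewrite (bigD1 a)//=.
have hwa : \sum_(b < J | b != a) w b <=
    \sum_(b < J | b != a) gain i (upd x i b) * w b.
  by apply: ler_sum => b ba; rewrite -[leLHS]mul1r ler_wpM2r// hb.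
have := ler_wpM2r (w0 a) ha.
have := hw a; lra.
Qed.

(** When all other items have color [c], no tie is possible and the majority color is [c], so the
    strict inequality on [w c] carries over. *)
Lemma gain_sum_gt0 (w : 'I_J -> R) (c : 'I_J) (i : 'I_n) : (1 < n)%N ->
  (forall a, 0 <= w a) -> w c < \sum_(b < J | b != c) w b ->
  0 < \sum_b gain i (upd [tuple c | _ < n] i b) * w b.
Proof.
move=> n1 w0 hw.
have [[[k [k' [_ _ kk']]] _]|[a [[k ki ka] hb ha]]] :=
  gain_upd [tuple c | _ < n] i n1.
  by move: kk'; rewrite !tnth_mktuple eqxx.
move: ka; rewrite tnth_mktuple => ca; rewrite -{}ca in hb ha.
rewrite (bigD1 c)//=.
have hwa : \sum_(b < J | b != c) w b <=
    \sum_(b < J | b != c) gain i (upd [tuple c | _ < n] i b) * w b.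
  by apply: ler_sum => b ba; rewrite -[leLHS]mul1r ler_wpM2r// hb.
have := ler_wpM2r (w0 c) ha.
lra.
Qed.

Lemma lossE (A B : {set {set 'I_n}}) :
  loss R A B = 1 - n%:R^-1 * (overlap A B)%:R.
Proof. by []. Qed.

End Gain.

From mathcomp Require Import all_classical all_reals all_analysis.
From mathcomp Require Import measurable_realfun.
Import numFieldNormedType.Exports.

Local Open Scope classical_set_scope.
Local Open Scope ring_scope.

(** * Existence and comparison of conditional expectations *)

Section CondExp.
Context d d' (Om : measurableType d) (S : measurableType d') (R : realType).
Variables (P : probability Om R) (W : Om -> S).
Hypothesis mW : measurable_fun [set: Om] W.

(** Restates measurability of [W] without the intersection with [setT]. *)
Lemma measurable_preimageW (B : set S) : measurable B -> measurable (W @^-1` B).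
Proof. by move=> mB; rewrite -[X in measurable X]setTI; exact: mW. Qed.

(** A version exists: push the charge with density [U] forward along [W], take its Radon-Nikodym
    derivative with respect to the law of [W], and compose with [W]. Then [xget] returns a genuine
    version. *)
Lemma cond_expP (U : Om -> R) : P.-integrable [set: Om] (EFin \o U) ->
  is_cond_exp P W U (cond_exp P W U).
Proof.
move=> iU.
suff [Z hZ] : exists Z, is_cond_exp P W U Z.
  exact: (xgetPex (fun=> 0) (ex_intro _ Z hZ)).
pose W' : {mfun Om >-> S} :=
  HB.pack W (isMeasurableFun.Build _ _ _ _ W mW).
pose nu : {charge set Om -> \bar R} := induced_charge iU.
pose nuW : {charge set S -> \bar R} :=
  measure_function_pushforward__canonical__charge_Charge nu mW.
pose mu := distribution P W'.
have ac : nuW `<< mu.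
  apply: (@dominates_pushforward _ _ _ _ R P nu W mW).
  apply/null_content_dominatesP => A mA PA.
  rewrite /nu/= /induced_charge null_set_integral//.
  exact/measurable_funTS/(measurable_int _ iU).
have fin := Radon_Nikodym_fin_num _ ac.
pose f := Radon_Nikodym nuW mu.
have iF : mu.-integrable setT f by exact: Radon_Nikodym_integrable.
have mf : measurable_fun setT f by exact: measurable_int iF.
have ifW : P.-integrable setT (f \o W).
  apply/integrableP; split; first exact: measurableT_comp.
  have /integrableP[_] := iF; rewrite ge0_integral_pushforward//.
  exact: measurableT_comp.
exists (fine \o f \o W); split.
- have mW' : measurable_fun setT (W : g_sigma_algebra_preimageType W -> S).
    by move=> _ B mB; exists B.
  by apply: measurableT_comp => //; apply: measurableT_comp => //.
- by apply: eq_integrable ifW => // w _ /=; rewrite fineK.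
- move=> _ [B mB <-]; rewrite setTI.
  transitivity (nuW B); last by [].
  rewrite (Radon_Nikodym_integral ac mB).
  rewrite (@integral_pushforward _ _ _ _ R W' _ P B f mf)//; last first.
    exact: (integrableS measurableT (measurable_preimageW mB) _ ifW).
  by apply: eq_integral => w _ /=; rewrite fineK.
Qed.

(** Turns the almost-everywhere optimality of a Bayes rule into an inequality between integrals of
    the unconditioned losses over any event determined by [W]. *)
Lemma is_cond_exp_le (U U' Z Z' : Om -> R) (B : set S) :
  is_cond_exp P W U Z -> is_cond_exp P W U' Z' -> measurable B ->
  {ae P, forall w, Z w <= Z' w} ->
  (\int[P]_(w in W @^-1` B) (U w)%:E <= \int[P]_(w in W @^-1` B) (U' w)%:E)%E.
Proof.
move=> [_ iZ hZ] [_ iZ' hZ'] mB [N [mN PN ZZ']].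
have gA : g_sigma_algebra_preimage W (W @^-1` B).
  by exists B => //; rewrite setTI.
have mA := measurable_preimageW mB.
rewrite -(hZ _ gA) -(hZ' _ gA).
have iA Z0 : P.-integrable setT (EFin \o Z0) ->
    P.-integrable (W @^-1` B) (EFin \o Z0).
  exact: (integrableS measurableT mA).
(* Remove the null set [N], off which the inequality holds pointwise. *)
rewrite (negligible_integral mN mA (iA _ iZ) PN).
rewrite (negligible_integral mN mA (iA _ iZ') PN).
have mAN : measurable (W @^-1` B `\` N) by exact: measurableD.
apply: le_integral => //.
- exact: (integrableS measurableT mAN).
- exact: (integrableS measurableT mAN).
- move=> w /set_mem[_ Nw]; rewrite /= lee_fin.
  by apply: contrapT => nle; apply/Nw/ZZ'.
Qed.

End CondExp.

(** * Integrals of functions of a finitely valued variable *)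

Section Discrete.
Context d (Om : measurableType d) (R : realType) (P : probability Om R).
Context (F : finType) (f : Om -> F).
Hypothesis mf : discrete_measurable_fun f.

Lemma discrete_preimage (A : set F) : measurable (f @^-1` A).
Proof.
have -> : f @^-1` A = \bigcup_(a in A) f @^-1` [set a].
  apply/seteqP; split => [w Aw|w [a Aa /= fwa]].
    by exists (f w).
  by rewrite /= fwa.
by apply: fin_bigcup_measurable => [|a _]; [exact: finite_finset|exact: mf].
Qed.

Lemma discrete_integrable (phi : F -> R) (A : set Om) : measurable A ->
  P.-integrable A (EFin \o (phi \o f)).
Proof.
move=> mA.
apply: measurable_bounded_integrable => //.
- by rewrite (le_lt_trans (probability_le1 _ _))// ltry.
- move=> _ B mB; apply: measurableI; first exact: mA.
  exact: (discrete_preimage (phi @^-1` B)).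
exists (\sum_a `|phi a|); split; first by rewrite num_real.
move=> M hM w _ /=. apply: le_trans (ltW hM).
by rewrite (bigD1 (f w))//= lerDl sumr_ge0.
Qed.

Lemma integral_discrete (phi : F -> R) (A : set Om) : measurable A ->
  (\int[P]_(w in A) (phi (f w))%:E =
   (\sum_a phi a * fine (P (f @^-1` [set a] `&` A)))%R%:E)%E.
Proof.
move=> mA.
pose g a w := ((phi a)%:E * (\1_(f @^-1` [set a]) w)%:E)%E.
have ig a : P.-integrable A (EFin \o \1_(f @^-1` [set a])).
  by apply: (integrableS measurableT mA) => //; exact: integrable_indic.
rewrite (eq_integral (fun w => \sum_a g a w)%E); last first.
  move=> w _; rewrite (bigD1 (f w))//= /g indicE mem_set// mule1.
  rewrite big1 ?adde0// => a afw; rewrite indicE memNset ?mule0//=.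
  by move=> fwa; rewrite fwa eqxx in afw.
rewrite integral_sum//; last by move=> a; exact: (integrableZl mA _ (ig a)).
rewrite -sumEFin; apply: eq_bigr => a _.
rewrite (integralZl mA (ig a)) /= integral_indic// EFinM fineK//.
by rewrite fin_num_measure//; exact: measurableI.
Qed.

End Discrete.

(** * Change of variables for a measure given by a density *)

Section Density.
Context d (T : measurableType d) (R : realType).
Variables (nu : {measure set T -> \bar R})
  (mu : {sigma_finite_measure set T -> \bar R}) (w : T -> R).
Hypotheses (nuT : (nu setT < +oo)%E) (mw : measurable_fun setT w).
Hypothesis nuE : forall A, measurable A ->
  nu A = (\int[mu]_(y in A) (w y)%:E)%E.

(** The Radon-Nikodym derivative of [nu] and [w] have the same integral over every measurable set,
    so they agree [mu]-almost everywhere. *)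
Lemma integral_density (phi : T -> R) (A : set T) : measurable A ->
  measurable_fun setT phi -> (forall y, 0 <= phi y) ->
  (\int[nu]_(y in A) (phi y)%:E = \int[mu]_(y in A) (phi y * w y)%:E)%E.
Proof.
move=> mA mphi phi0.
(* Restricting to [setT] leaves the values unchanged and supplies the finite-measure structure. *)
pose nu' : {finite_measure set T -> \bar R} := mfrestr measurableT nuT.
have nu'E B : nu' B = nu B by rewrite /nu'/= /mfrestr /mrestr setIT.
have ac : nu' `<< mu.
  apply/null_content_dominatesP => B mB B0; rewrite nu'E nuE//.
  rewrite null_set_integral//.
  by apply/measurable_funTS/measurable_EFinP.
have mphi' : measurable_fun A (EFin \o phi).
  exact/measurable_funTS/measurable_EFinP.
rewrite (eq_measure_integral nu') => [|B mB _]; last by rewrite -nu'E.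
rewrite -[LHS](@Radon_Nikodym_SigmaFinite.change_of_variables _ _ _ nu' mu)//.
apply: ae_eq_integral => //.
- apply: emeasurable_funM => //; apply: measurable_funTS.
  exact: measurable_int (Radon_Nikodym_SigmaFinite.f_integrable ac).
- apply/measurable_funTS/measurable_EFinP; exact: measurable_funM.
have /ae_eq_subset h : ae_eq mu setT
    (Radon_Nikodym_SigmaFinite.f nu' mu) (EFin \o w).
  apply: integral_ae_eq => //.
  - exact: Radon_Nikodym_SigmaFinite.f_integrable.
  - exact/measurable_EFinP.
  - by move=> E _ mE; rewrite -nuE// -Radon_Nikodym_SigmaFinite.f_integral.
under [X in ae_eq _ _ _ X]eq_fun do rewrite EFinM.
apply: ae_eqe_mul2l.
exact: h.
Qed.

End Density.

(** * Rectangles generate the sigma-algebra on tuples and determine finite measures *)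

Section Rectangles.
Context d (T : measurableType d) (n : nat).

Definition rectangle (B : 'I_n -> set T) : set (n.-tuple T) :=
  [set y | forall i, B i (tnth y i)].

Definition rectangles : set (set (n.-tuple T)) :=
  [set A | exists2 B, (forall i, measurable (B i)) & A = rectangle B].

Lemma measurable_rectangle (B : 'I_n -> set T) : (forall i, measurable (B i)) ->
  measurable (rectangle B).
Proof.
move=> mB.
have -> : rectangle B = \bigcap_(i in [set: 'I_n]) ((@tnth n T ^~ i) @^-1` B i).
  by apply/seteqP; split => [y By i _|y By i]; [exact: By|exact: (By i)].
apply: fin_bigcap_measurable => [|i _]; first exact: finite_finset.
rewrite -[X in measurable X]setTI.
by apply: measurable_tnth.
Qed.

(** A coordinate preimage is the rectangle with [setT] in all other coordinates; conversely a
    rectangle is a finite intersection of coordinate preimages. *)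
Lemma measurable_tupleE : @measurable _ (n.-tuple T) = <<s rectangles >>.
Proof.
apply/seteqP; split.
  apply: smallest_sub; first exact: smallest_sigma_algebra.
  move=> A; rewrite -bigcup_seq/= => -[i _ [B mB <-]].
  apply: sub_sigma_algebra.
  exists (fun k => if k == i then B else setT); first by move=> k; case: eqP.
  rewrite setTI; apply/seteqP; split => [y By k|y /(_ i)]; rewrite ?eqxx//.
  by case: eqP => // ->.
apply: smallest_sub; first exact: sigma_algebra_measurable.
by move=> _ [B mB ->]; exact: measurable_rectangle.
Qed.

Lemma setI_closed_rectangles : setI_closed rectangles.
Proof.
move=> _ _ [A mA ->] [B mB ->]; exists (fun i => A i `&` B i).
  by move=> i; exact: measurableI.
apply/seteqP; split => [y [Ay By] i|y ABy].
  by split; [exact: Ay|exact: By].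
by split => i; have [] := ABy i.
Qed.

Lemma measure_tuple_unique (R : realType)
    (m1 m2 : {measure set (n.-tuple T) -> \bar R}) A :
  (m1 setT < +oo)%E ->
  (forall B, (forall i, measurable (B i)) ->
    m1 (rectangle B) = m2 (rectangle B)) ->
  measurable A -> m1 A = m2 A.
Proof.
move=> m1T m12; apply: (measure_unique rectangles (fun=> setT)) => //.
- exact: measurable_tupleE.
- exact: setI_closed_rectangles.
- by move=> _; exists (fun=> setT) => //; apply/seteqP.
- by rewrite bigcup_const//; exists 0%N.
- by move=> _ [B mB ->]; exact: m12.
Qed.

End Rectangles.

(** The complement of [G] is null for the restricted measure, and on subsets of [G] the two measures
    coincide. *)
Lemma ge0_integral_mrestr d (T : measurableType d) (R : realType)
    (mu : {measure set T -> \bar R}) (G A : set T) (mG : measurable G)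
    (f : T -> \bar R) :
  measurable A -> measurable_fun A f -> (forall x, (0 <= f x)%E) ->
  (\int[mrestr mu mG]_(x in A) f x = \int[mu]_(x in G `&` A) f x)%E.
Proof.
move=> mA mf f0.
rewrite [LHS](@ge0_negligible_integral _ _ _ _ _ (~` G))//; last 2 first.
- exact: measurableC.
- by rewrite /= /mrestr setICl measure0.
rewrite setDE setCK setIC; apply: eq_measure_integral => B mB BG.
by rewrite /= /mrestr setIidl// => x /BG[].
Qed.

Lemma measure_discrete d (Om : measurableType d) (R : realType)
    (P : probability Om R) (F : finType) (f : Om -> F) (A : set Om) :
  discrete_measurable_fun f -> measurable A ->
  P A = (\sum_a fine (P (f @^-1` [set a] `&` A)))%R%:E.
Proof.
move=> mf mA; rewrite -[LHS]mul1e -integral_cst//.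
rewrite (@integral_discrete _ _ _ _ _ f mf (fun=> 1) A mA).
by under eq_bigr do rewrite mul1r.
Qed.

Lemma prob_bigcup_gt0 d (Om : measurableType d) (R : realType)
    (P : probability Om R) (I : finType) (S : set I) (B : I -> set Om) :
  (forall i, measurable (B i)) -> (0 < P (\bigcup_(i in S) B i))%E ->
  exists2 i, S i & (0 < P (B i))%E.
Proof.
move=> mB; apply: contraPP => /forall2NP h; apply/negP; rewrite -leNgt.
have mSB : measurable (\bigcup_(i in S) B i) by exact: fin_bigcup_measurable.
have /= := @content_sub_fsum _ _ _ P I S _ B finite_finset
  (fun i _ => mB i) mSB (@subset_refl _ _).
rewrite fsbig1// => i Si; apply/eqP; rewrite -measure_le0 leNgt; apply/negP.
by case: (h i).
Qed.

Lemma discrete_pair d (Om : measurableType d) (F G : finType) (f : Om -> F)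
    (g : Om -> G) :
  discrete_measurable_fun f -> discrete_measurable_fun g ->
  discrete_measurable_fun (fun w => (f w, g w)).
Proof.
move=> mf mg [a b].
rewrite (_ : _ @^-1` _ = f @^-1` [set a] `&` g @^-1` [set b]).
  exact: measurableI.
by apply/seteqP; split => w /=; [case|move=> [-> ->]].
Qed.

Lemma discrete_comp d d' (Om : measurableType d) (S : measurableType d')
    (F : Type) (f : S -> F) (W : Om -> S) :
  measurable_fun setT W -> discrete_measurable_fun f ->
  discrete_measurable_fun (f \o W).
Proof. by move=> mW mf a; exact: (measurable_preimageW mW (mf a)). Qed.

(** * The measure with a given nonnegative density, and strict positivity of integrals *)

Section DensityMeasure.
Context d (T : measurableType d) (R : realType).
Variables (mu : {measure set T -> \bar R}) (f : T -> \bar R).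
Hypotheses (mf : measurable_fun setT f) (f0 : forall x, (0 <= f x)%E).

(* The proofs are arguments so that the measure structure below can be inferred
   from the term. *)
Definition density_measure of measurable_fun setT f & (forall x, (0 <= f x)%E)
  := fun A : set T => (\int[mu]_(x in A) f x)%E.

Let nu := density_measure mf f0.

Let nu0 : nu set0 = 0%E. Proof. exact: integral_set0. Qed.

Let nu_ge0 A : (0 <= nu A)%E. Proof. exact: integral_ge0. Qed.

HB.instance Definition _ := isMeasure.Build _ _ _ nu nu0 nu_ge0
  (semi_sigma_additive_nng_induced mf f0).

End DensityMeasure.

(** If the integral vanished, [f] would be zero almost everywhere on [A], which would force [A] to
    be null. *)
Lemma integral_gt0 d (T : measurableType d) (R : realType)
    (mu : {measure set T -> \bar R}) (A : set T) (f : T -> \bar R) :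
  measurable A -> measurable_fun A f -> (forall x, A x -> (0 < f x)%E) ->
  (0 < mu A)%E -> (0 < \int[mu]_(x in A) f x)%E.
Proof.
move=> mA mf f0 A0; rewrite lt_neqAle integral_ge0 ?andbT; last first.
  by move=> x Ax; exact/ltW/f0.
apply/eqP => /esym If0; move: A0; rewrite lt_neqAle => /andP[/eqP + _]; apply.
have : (\int[mu]_(x in A) `|f x| = 0)%E.
  rewrite -[RHS]If0; apply: eq_integral => x /set_mem Ax.
  by rewrite gee0_abs//; exact/ltW/f0.
move=> /(ae_eq_integral_abs _ mA mf)[N [mN N0 AN]].
apply/esym/(subset_measure0 mA mN _ N0) => x Ax; apply: AN => /(_ Ax) /= fx0.
by have := f0 _ Ax; rewrite fx0 ltxx.
Qed.

(** * The independent model: weights, posteriors and masses *)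

Section Model.
Context (R : realType) (J : nat) (T : ptopologicalType).
Context (L : {sigma_finite_measure set (borel T) -> \bar R}).
Context (theta : hmm_param R J T) (htheta : Theta_ind L theta).
Context (d : measure_display) (Om : measurableType d) (P : probability Om R).
Context (X : nat -> Om -> 'I_J) (Y : nat -> Om -> borel T).
Context (hXY : is_hmm L P X Y theta).

Definition weight (l : 'I_J) (y : borel T) : R :=
  init theta 0 l * dens theta l y.

(** Where all weights vanish the quotient is 0, so the values sum to 0 there instead of 1. *)
Definition posterior (l : 'I_J) (y : borel T) : R :=
  weight l y / \sum_k weight k y.

(** The joint probability that an item has color [l] and its observation lies in [B]. *)
Definition mass (l : 'I_J) (B : set (borel T)) : R :=
  init theta 0 l * (\int[L]_(y in B) dens theta l y)%R.

Lemma weight_ge0 l y : 0 <= weight l y.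
Proof.
have [[[i0 _] _ hf] _] := htheta; have [_ f0 _] := hf l.
by rewrite mulr_ge0.
Qed.

Lemma measurable_weight l : measurable_fun setT (weight l).
Proof.
have [[_ _ hf] _] := htheta; have [mf _ _] := hf l.
exact: measurable_funM.
Qed.

Lemma measurable_sum_weight : measurable_fun setT (fun y => \sum_l weight l y).
Proof. by apply: measurable_sum => l; exact: measurable_weight. Qed.

Lemma posterior_ge0 l y : 0 <= posterior l y.
Proof. by rewrite divr_ge0 ?sumr_ge0// => *; exact: weight_ge0. Qed.

Lemma posterior_le1 l y : posterior l y <= 1.
Proof.
have [s0|s0] := eqVneq (\sum_k weight k y) 0.
  by rewrite /posterior s0 invr0 mulr0.
have sp : 0 < \sum_k weight k y.
  by rewrite lt_neqAle eq_sym s0 sumr_ge0// => *; exact: weight_ge0.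
rewrite ler_pdivrMr// mul1r (bigD1 l)//= lerDl sumr_ge0// => *.
exact: weight_ge0.
Qed.

Lemma posteriorM l y : posterior l y * \sum_k weight k y = weight l y.
Proof.
have [s0|s0] := eqVneq (\sum_k weight k y) 0; last by rewrite divfK.
rewrite s0 mulr0; apply/esym/eqP.
have /eqP := s0; rewrite psumr_eq0 => [/allP/(_ l)|*]; last exact: weight_ge0.
by rewrite mem_index_enum => /(_ isT).
Qed.

Lemma measurable_posterior l : measurable_fun setT (posterior l).
Proof.
(* The inverse is written as a real power, whose measurability is available; the two agree on
   nonnegative numbers. *)
rewrite (_ : posterior l = fun y => weight l y * (\sum_k weight k y) `^ (-1)).
  apply: measurable_funM; first exact: measurable_weight.
  exact: (measurableT_comp (measurable_powR (-1)) measurable_sum_weight).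
apply/funext => y; rewrite powR_inv1// sumr_ge0// => k _; exact: weight_ge0.
Qed.

Lemma integrable_dens l : L.-integrable setT (EFin \o dens theta l).
Proof.
have [[_ _ hf] _] := htheta; have [mf f0 f1] := hf l.
apply/integrableP; split; first exact/measurable_EFinP.
under eq_integral do rewrite /= ger0_norm//.
by rewrite f1 ltry.
Qed.

Lemma massE l B : measurable B ->
  (mass l B)%:E = (\int[L]_(y in B) (weight l y)%:E)%E.
Proof.
move=> mB.
have iB : L.-integrable B (EFin \o dens theta l).
  by apply: (integrableS measurableT mB) => //; exact: integrable_dens.
rewrite /mass EFinM /Rintegral fineK; last exact: integrable_fin_num.
by rewrite -integralZl//; apply: eq_integral => y _; rewrite /weight EFinM.
Qed.

Lemma integrable_weight l B : measurable B ->
  L.-integrable B (fun y => (weight l y)%:E).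
Proof.
move=> mB; apply: (@eq_integrable _ _ _ L B mB
  (fun y => (init theta 0 l)%:E * (dens theta l y)%:E)%E).
  by move=> y _; rewrite /weight EFinM.
apply: integrableZl => //.
by apply: (integrableS measurableT mB) => //; exact: integrable_dens.
Qed.

(** * Joint law of colors and observations *)

Lemma measurable_Y i : measurable_fun setT (Y i).
Proof. by have [_ [mY _]] := hXY. Qed.

Lemma measurable_preimageY i B : measurable B -> measurable (Y i @^-1` B).
Proof. exact: (measurable_preimageW (@measurable_Y i)). Qed.

Lemma discrete_X i : discrete_measurable_fun (X i).
Proof. by have [[mX _ _] _] := hXY. Qed.

Lemma measurable_prefixY n : measurable_fun setT (prefix_of Y n).
Proof.
apply/measurable_fun_tnthP => i.
rewrite (_ : _ \o _ = Y i); first exact: measurable_Y.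
by apply/funext => w; rewrite /= tnth_mktuple.
Qed.

Lemma discrete_prefixX n : discrete_measurable_fun (prefix_of X n).
Proof.
move=> x; rewrite (_ : _ @^-1` _ =
    \bigcap_(i in [set: 'I_n]) (X i @^-1` [set tnth x i])).
  apply: fin_bigcap_measurable => [|i _]; first exact: finite_finset.
  exact: discrete_X.
apply/seteqP; split => [w <- i _|w hw]; first by rewrite /= tnth_mktuple.
by apply: eq_from_tnth => i; rewrite tnth_mktuple (hw i).
Qed.

(** Every row of the transition matrix is the initial law, so the Markov chain rule becomes a
    product. Length 0 is treated apart because the chain rule extends nonempty prefixes. *)
Lemma prob_prefix n (x : n.-tuple 'I_J) :
  P [set w | prefix_of X n w = x] = (\prod_(i < n) init theta 0 (tnth x i))%:E.
Proof.
have [[_ hX0 hXS] _] := hXY; have [_ rowQ] := htheta.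
have Q a b : trans theta a b = init theta 0 b.
  by rewrite -(rowQ a) mxE.
case: n x => [|n] x.
  rewrite big_ord0 -(probability_setT P); congr (P _).
  by apply/seteqP; split => // w _ /=; rewrite [LHS]tuple0 [RHS]tuple0.
elim: n x => [|n IH] x.
  rewrite big_ord_recl big_ord0 mulr1 -hX0; congr (P _).
  apply/seteqP; split => w /=; first by move=> <-; rewrite tnth_mktuple.
  move=> Xw; apply: eq_from_tnth => i; rewrite tnth_mktuple.
  by rewrite [i]ord1.
pose x' := [tuple tnth x (widen_ord (leqnSn _) i) | i < n.+1].
rewrite big_ord_recr/= EFinM -(Q (tnth x' ord_max)).
rewrite (_ : \prod_(i < n.+1) _ = \prod_(i < n.+1) init theta 0 (tnth x' i)).
  rewrite -IH -hXS; congr (P _); apply/seteqP; split => w /=.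
    move=> wx; split; last by rewrite -wx tnth_mktuple.
    by apply: eq_from_tnth => i; rewrite !tnth_mktuple -wx tnth_mktuple.
  move=> [wx' wx]; apply: eq_from_tnth => i.
  rewrite tnth_mktuple; have [ni|ni] := ltnP i n.+1.
    have := congr1 (fun t => tnth t (Ordinal ni)) wx'.
    rewrite !tnth_mktuple /= => ->.
    by congr tnth; apply/val_inj.
  have -> : i = ord_max by apply/val_inj/eqP; rewrite eqn_leq ni -ltnS ltn_ord.
  by [].
by apply: eq_bigr => i _; rewrite tnth_mktuple.
Qed.

Lemma prob_joint n (x : n.-tuple 'I_J) (B : 'I_n -> set (borel T)) :
  (forall i, measurable (B i)) ->
  P (prefix_of X n @^-1` [set x] `&` prefix_of Y n @^-1` rectangle B) =
  (\prod_(i < n) mass (tnth x i) (B i))%:E.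
Proof.
move=> mB; have [_ [_ hY]] := hXY.
rewrite /mass big_split/= EFinM -prob_prefix -hY//; congr (P _).
apply/seteqP; split => w /=; rewrite /rectangle/=.
  by move=> [-> Bw]; split => // i; have := Bw i; rewrite tnth_mktuple.
by move=> [-> Bw]; split => // i; rewrite tnth_mktuple.
Qed.

(** * Posterior law of one color given the observations and the other colors *)

Definition set_coord n (B : 'I_n -> set (borel T)) i D k :=
  if k == i then D else B k.

Lemma set_coord_measurable n (B : 'I_n -> set (borel T)) i D k :
  (forall k, measurable (B k)) -> measurable D ->
  measurable (set_coord B i D k).
Proof. by rewrite /set_coord => mB mD; case: eqP. Qed.

(** A prefix in [range (upd x i)] agrees with [x] at every item except possibly [i]; fixing the
    color of [i] as well determines it. *)
Lemma prefix_upd n (x : n.-tuple 'I_J) (i : 'I_n) c :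
  X i @^-1` [set c] `&` prefix_of X n @^-1` range (upd x i) =
  prefix_of X n @^-1` [set upd x i c].
Proof.
apply/seteqP; split => w /=.
  move=> [<- [b _ bw]]; rewrite -bw; congr upd.
  by have := congr1 (fun t => tnth t i) bw; rewrite tnth_updi tnth_mktuple.
move=> wc; split; last by exists c.
by have := congr1 (fun t => tnth t i) wc; rewrite tnth_updi tnth_mktuple.
Qed.

Lemma measurable_class n (x : n.-tuple 'I_J) (i : 'I_n) :
  measurable (prefix_of X n @^-1` range (upd x i)).
Proof. exact: (discrete_preimage (@discrete_prefixX n)).  Qed.

Lemma prob_upd n (x : n.-tuple 'I_J) (i : 'I_n) c B :
  (forall k, measurable (B k)) ->
  P (prefix_of X n @^-1` [set upd x i c] `&` prefix_of Y n @^-1` rectangle B) =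
  ((\prod_(k < n | k != i) mass (tnth x k) (B k)) * mass c (B i))%:E.
Proof.
move=> mB; rewrite prob_joint// (bigD1 i)//= tnth_updi mulrC.
congr (_ * _)%:E; apply: eq_bigr => k ki.
by rewrite tnth_upd (negbTE ki).
Qed.

Lemma prob_class n (x : n.-tuple 'I_J) (i : 'I_n) B :
  (forall k, measurable (B k)) ->
  P (prefix_of X n @^-1` range (upd x i) `&` prefix_of Y n @^-1` rectangle B) =
  ((\prod_(k < n | k != i) mass (tnth x k) (B k)) * \sum_c mass c (B i))%:E.
Proof.
move=> mB; rewrite (measure_discrete P (@discrete_X i)); last first.
  apply: measurableI; first exact: measurable_class.
  exact: (measurable_preimageW (@measurable_prefixY n)
    (measurable_rectangle mB)).
rewrite mulr_sumr; congr _%:E; apply: eq_bigr => c _.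
by rewrite setIA prefix_upd prob_upd.
Qed.

(** With the other coordinates constrained, the law of [Y i] has density [K] times the total weight;
    multiplying by the posterior cancels the total and leaves [K] times the weight of [b]. *)
Lemma posterior_rectangle n (x : n.-tuple 'I_J) (i : 'I_n) b B :
  (forall k, measurable (B k)) ->
  P (prefix_of X n @^-1` [set upd x i b] `&` prefix_of Y n @^-1` rectangle B) =
  (\int[P]_(w in prefix_of X n @^-1` range (upd x i) `&`
      prefix_of Y n @^-1` rectangle B) (posterior b (Y i w))%:E)%E.
Proof.
move=> mB; rewrite prob_upd//.
set K := \prod_(k < n | _) _.
(* Coordinate [i] is freed in [G], so that the constraint on [Y i] can vary over all measurable
   [D]. *)
pose G := prefix_of X n @^-1` range (upd x i) `&`
  prefix_of Y n @^-1` rectangle (set_coord B i setT).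
have GE D : G `&` Y i @^-1` D = prefix_of X n @^-1` range (upd x i) `&`
    prefix_of Y n @^-1` rectangle (set_coord B i D).
  rewrite -setIA; congr (_ `&` _); apply/seteqP; split => w /=.
    move=> [Bw Dw] k; have := Bw k; rewrite /set_coord tnth_mktuple.
    by case: eqVneq => [->|].
  move=> Bw; split => [k|]; last first.
    by have := Bw i; rewrite /set_coord eqxx tnth_mktuple.
  by have := Bw k; rewrite /set_coord; case: eqVneq.
have mG : measurable G.
  apply: measurableI; first exact: measurable_class.
  apply: (measurable_preimageW (@measurable_prefixY n)).
  by apply: measurable_rectangle => k; exact: set_coord_measurable.
have K0 : 0 <= K.
  apply: prodr_ge0 => k _; have [[[i0 _] _ hf] _] := htheta.
  by rewrite mulr_ge0// Rintegral_ge0// => y _; have [_ f0 _] := hf (tnth x k).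
have := GE (B i); rewrite (_ : set_coord B i (B i) = B); last first.
  by apply/funext => k; rewrite /set_coord; case: eqVneq => [->|].
move=> <-.
pose Q : {measure set Om -> \bar R} := mrestr P mG.
have mpost : measurable_fun setT (fun w => (posterior b (Y i w))%:E).
  apply/measurable_EFinP.
  exact: (measurableT_comp (measurable_posterior b) (@measurable_Y i)).
rewrite -(@ge0_integral_mrestr _ _ _ P G _ mG
  (fun w => (posterior b (Y i w))%:E));
  last 3 first.
- exact: measurable_preimageY.
- exact: measurable_funTS.
- by move=> w; rewrite lee_fin posterior_ge0.
rewrite -(@ge0_integral_pushforward _ _ _ _ _ (Y i) (@measurable_Y i) Q (B i)
  (EFin \o posterior b))//; last 2 first.
- by apply/measurable_funTS/measurable_EFinP; exact: measurable_posterior.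
- by move=> y _; rewrite lee_fin posterior_ge0.
pose nu : {measure set (borel T) -> \bar R} :=
  measure_function_pushforward__canonical__measure_function_Measure
    Q (@measurable_Y i).
rewrite -[X in _ = X]/(\int[nu]_(y in B i) (posterior b y)%:E)%E.
(* The density of [nu] is checked on each [D] through [prob_class]. *)
rewrite (@integral_density _ _ _ nu L (fun y => K * \sum_l weight l y))//.
- rewrite mulrC EFinM massE// -integralZr//; last exact: integrable_weight.
  by apply: eq_integral => y _; rewrite mulrCA posteriorM mulrC EFinM.
- rewrite (le_lt_trans _ (ltry 1))//; apply: probability_le1.
  by rewrite preimage_setT setTI.
- by apply: measurable_funM => //; exact: measurable_sum_weight.
- move=> D mD; rewrite /= /pushforward /= /Q /= /mrestr setIC GE.
  rewrite prob_class; last by move=> k; exact: set_coord_measurable.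
  rewrite (_ : \prod_(k < n | _) _ = K); last first.
    by apply: eq_bigr => k ki; rewrite /set_coord (negbTE ki).
  rewrite {1}/set_coord eqxx EFinM -sumEFin.
  under [in LHS]eq_bigr do rewrite massE//.
  rewrite -integral_sum//; last by move=> l; exact: integrable_weight.
  rewrite -integralZl//; last first.
    by apply: integrable_sum => // l _; exact: integrable_weight.
  by apply: eq_integral => y _; rewrite sumEFin EFinM.
- exact: measurable_posterior.
- by move=> y; exact: posterior_ge0.
Qed.

(* Given all the observations and the other colors, color i has the law
   posterior _ (Y i).  Both sides are finite measures in A. *)
Lemma posteriorP n (x : n.-tuple 'I_J) (i : 'I_n) b
    (A : set (n.-tuple (borel T))) : measurable A ->
  P (prefix_of X n @^-1` [set upd x i b] `&` prefix_of Y n @^-1` A) =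
  (\int[P]_(w in prefix_of X n @^-1` range (upd x i) `&`
      prefix_of Y n @^-1` A) (posterior b (Y i w))%:E)%E.
Proof.
move=> mA.
have mpost : measurable_fun setT (fun w => (posterior b (Y i w))%:E).
  apply/measurable_EFinP.
  exact: (measurableT_comp (measurable_posterior b) (@measurable_Y i)).
have post0 w : (0 <= (posterior b (Y i w))%:E)%E.
  by rewrite lee_fin posterior_ge0.
have mC := measurable_class x i.
have mCb := @discrete_prefixX n (upd x i b).
pose m1 : {measure set (n.-tuple (borel T)) -> \bar R} :=
  measure_function_pushforward__canonical__measure_function_Measure
    (mrestr P mCb) (@measurable_prefixY n).
pose m2 : {measure set (n.-tuple (borel T)) -> \bar R} :=
  measure_function_pushforward__canonical__measure_function_Measure
    (density_measure (mrestr P mC) mpost post0) (@measurable_prefixY n).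
have m1E D : m1 D =
    P (prefix_of X n @^-1` [set upd x i b] `&` prefix_of Y n @^-1` D).
  by rewrite /m1/= /pushforward /mrestr setIC.
have m2E D : measurable D -> m2 D =
    (\int[P]_(w in prefix_of X n @^-1` range (upd x i) `&`
      prefix_of Y n @^-1` D) (posterior b (Y i w))%:E)%E.
  move=> mD; have mWD := measurable_preimageW (@measurable_prefixY n) mD.
  rewrite /m2/= /pushforward/= /density_measure ge0_integral_mrestr//.
  exact: measurable_funTS.
rewrite -m1E -m2E//; apply: measure_tuple_unique => //.
- rewrite m1E (le_lt_trans _ (ltry 1))//; apply: probability_le1.
  by rewrite preimage_setT setIT.
- move=> B mB; rewrite m1E m2E ?posterior_rectangle//.
  exact: measurable_rectangle.
Qed.

(* (x, b) |-> (upd x i b, tnth x i) is an involution. *)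
Lemma sum_upd n (F : n.-tuple 'I_J -> R) (i : 'I_n) :
  \sum_x \sum_b F (upd x i b) = (\sum_x F x) *+ J.
Proof.
pose swap (u : n.-tuple 'I_J * 'I_J) := (upd u.1 i u.2, tnth u.1 i).
have swapK : involutive swap.
  by move=> [x b]; rewrite /swap/= updK tnth_updi.
rewrite pair_big/=.
transitivity (\sum_(u : n.-tuple 'I_J * 'I_J) F u.1).
  by rewrite [RHS](reindex_inj (inv_inj swapK)).
rewrite -(pair_big xpredT xpredT (fun x _ => F x))/= -sumrMnl.
by apply: eq_bigr => x _; rewrite sumr_const card_ord.
Qed.

(** Linear combination of [posteriorP] over [b]: the integrand on the right is the conditional mean
    of [D] when only color [i] is random. *)
Lemma integral_upd n (D : n.-tuple 'I_J -> R) (i : 'I_n) x A : measurable A ->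
  (\sum_b D (upd x i b) * fine (P (prefix_of X n @^-1` [set upd x i b] `&`
     prefix_of Y n @^-1` A)))%:E =
  (\int[P]_(w in prefix_of X n @^-1` range (upd x i) `&` prefix_of Y n @^-1` A)
     (\sum_b D (upd x i b) * posterior b (Y i w))%:E)%E.
Proof.
move=> mA.
have mCA : measurable (prefix_of X n @^-1` range (upd x i) `&`
    prefix_of Y n @^-1` A).
  apply: measurableI; first exact: measurable_class.
  exact: (measurable_preimageW (@measurable_prefixY n)).
have ipost b : P.-integrable (prefix_of X n @^-1` range (upd x i) `&`
    prefix_of Y n @^-1` A) (fun w => (posterior b (Y i w))%:E).
  apply: measurable_bounded_integrable => //.
  - by rewrite (le_lt_trans (probability_le1 _ _))// ltry.
  - apply: measurable_funTS.
    exact: (measurableT_comp (measurable_posterior b) (@measurable_Y i)).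
  exists 1; split; first exact: real1.
  move=> M M1 w _ /=; rewrite ger0_norm ?posterior_ge0//.
  exact: le_trans (posterior_le1 _ _) (ltW M1).
under [in RHS]eq_integral do rewrite -sumEFin.
rewrite integral_sum//; last first.
  move=> b; apply: (@eq_integrable _ _ _ P _ mCA
    (fun w => (D (upd x i b))%:E * (posterior b (Y i w))%:E)%E).
    by move=> w _; rewrite EFinM.
  exact: integrableZl.
rewrite -sumEFin; apply: eq_bigr => b _.
rewrite EFinM fineK ?posteriorP//; last first.
  exact: integrable_fin_num.
by rewrite -integralZl//; apply: eq_integral => w _; rewrite EFinM.
Qed.

(** * Strict positivity of averages and of color events *)

Lemma sum_posteriorE (D : 'I_J -> R) y :
  \sum_b D b * posterior b y = (\sum_b D b * weight b y) / \sum_k weight k y.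
Proof. by rewrite mulr_suml; apply: eq_bigr => b _; rewrite mulrA. Qed.

Lemma sum_posterior_ge0 (D : 'I_J -> R) y :
  0 <= \sum_b D b * weight b y -> 0 <= \sum_b D b * posterior b y.
Proof.
move=> D0; rewrite sum_posteriorE divr_ge0// sumr_ge0// => k _.
exact: weight_ge0.
Qed.

(** A positive numerator forces some weight to be nonzero, hence a positive denominator. *)
Lemma sum_posterior_gt0 (D : 'I_J -> R) y :
  0 < \sum_b D b * weight b y -> 0 < \sum_b D b * posterior b y.
Proof.
move=> D0; rewrite sum_posteriorE divr_gt0// lt_neqAle sumr_ge0 ?andbT.
  rewrite eq_sym psumr_neq0; last by move=> *; exact: weight_ge0.
  apply: contraTT D0 => /hasPn w0; rewrite big1 ?ltxx// => b _.
  have := w0 b (mem_index_enum b); rewrite lt_neqAle weight_ge0 andbT negbK.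
  by move=> /eqP <-; rewrite mulr0.
by move=> *; exact: weight_ge0.
Qed.

(** Common engine for both Bayes rules: it suffices to average [D] over the color of item [i] alone.
    Each coloring of the other items contributes a nonnegative amount, and that of [x0] a positive
    one on an event of positive probability. *)
Lemma integral_prefix_gt0 n (D : n.-tuple 'I_J -> R) (i : 'I_n) x0 A :
  measurable A ->
  (forall w, A (prefix_of Y n w) -> forall x,
     0 <= \sum_b D (upd x i b) * weight b (Y i w)) ->
  (forall w, A (prefix_of Y n w) ->
     0 < \sum_b D (upd x0 i b) * weight b (Y i w)) ->
  (0 < P (prefix_of X n @^-1` [set x0] `&` prefix_of Y n @^-1` A))%E ->
  (0 < \int[P]_(w in prefix_of Y n @^-1` A) (D (prefix_of X n w))%:E)%E.
Proof.
move=> mA D0 Dx0 Px0.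
have mWA := measurable_preimageW (@measurable_prefixY n) mA.
have mCA x : measurable (prefix_of X n @^-1` range (upd x i) `&`
    prefix_of Y n @^-1` A).
  by apply: measurableI => //; exact: measurable_class.
rewrite (@integral_discrete _ _ _ _ _ _ (@discrete_prefixX n))// lte_fin.
pose F x :=
  D x * fine (P (prefix_of X n @^-1` [set x] `&` prefix_of Y n @^-1` A)).
(* Summing over all [x] counts each class of colorings [J] times; [J] is positive since [tnth x0 i]
   inhabits ['I_J]. *)
suff : 0 < (\sum_x F x) *+ J.
  rewrite pmulrn_lgt0// lt0n; apply/eqP => J0.
  by move: (tnth x0 i); rewrite J0 => -[].
rewrite -(sum_upd F i) (bigD1 x0)//= ltr_pwDl//.
  rewrite -lte_fin integral_upd//; apply: integral_gt0 => //.
  - apply/measurable_funTS/measurable_EFinP; apply: measurable_sum => b.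
    apply: measurable_funM => //.
    exact: (measurableT_comp (measurable_posterior b) (@measurable_Y i)).
  - by move=> w [_ Aw]; rewrite lte_fin sum_posterior_gt0// Dx0.
  - apply: lt_le_trans Px0 _; apply: le_measure; rewrite ?inE//.
      by apply: measurableI => //; exact: discrete_prefixX.
    move=> w [wx0 Aw]; split => //.
    by exists (tnth x0 i) => //; rewrite updi wx0.
apply: sumr_ge0 => x _; rewrite -lee_fin integral_upd//.
by apply: integral_ge0 => w [_ Aw]; rewrite lee_fin sum_posterior_ge0// D0.
Qed.

(** By [posteriorP] the new probability integrates a positive posterior over an event containing the
    old one. *)
Lemma prob_upd_gt0 n x (i : 'I_n) a A : measurable A ->
  (forall w, A (prefix_of Y n w) -> 0 < weight a (Y i w)) ->
  (0 < P (prefix_of X n @^-1` [set x] `&` prefix_of Y n @^-1` A))%E ->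
  (0 < P (prefix_of X n @^-1` [set upd x i a] `&` prefix_of Y n @^-1` A))%E.
Proof.
move=> mA wa Px; have mWA := measurable_preimageW (@measurable_prefixY n) mA.
have mCA : measurable (prefix_of X n @^-1` range (upd x i) `&`
    prefix_of Y n @^-1` A).
  by apply: measurableI => //; exact: measurable_class.
rewrite posteriorP//; apply: integral_gt0 => //.
- apply/measurable_funTS/measurable_EFinP.
  exact: (measurableT_comp (measurable_posterior a) (@measurable_Y i)).
- move=> w [_ /wa wa0]; rewrite lte_fin divr_gt0// (lt_le_trans wa0)//.
  by rewrite (bigD1 a)//= lerDl sumr_ge0// => *; exact: weight_ge0.
- apply: lt_le_trans Px _; apply: le_measure; rewrite ?inE//.
    by apply: measurableI => //; exact: discrete_prefixX.
  by move=> w [wx Aw]; split => //; exists (tnth x i) => //; rewrite updi wx.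
Qed.

Lemma prob_discrete_gt0 (F : finType) (f : Om -> F) A :
  discrete_measurable_fun f -> measurable A -> (0 < P A)%E ->
  exists a, (0 < P (f @^-1` [set a] `&` A))%E.
Proof.
move=> mf mA; rewrite (measure_discrete P mf mA) lte_fin => s0.
apply: contrapT => /forallNP h; move: s0; rewrite big1 ?ltxx// => a _.
by have /negP := h a; rewrite -leNgt measure_le0 => /eqP ->.
Qed.

Lemma prob_const_gt0 n a A : measurable A ->
  (forall w, A (prefix_of Y n w) -> forall i : 'I_n, 0 < weight a (Y i w)) ->
  (0 < P (prefix_of Y n @^-1` A))%E ->
  (0 < P (prefix_of X n @^-1` [set [tuple a | _ < n]] `&`
    prefix_of Y n @^-1` A))%E.
Proof.
move=> mA wa PA; have mWA := measurable_preimageW (@measurable_prefixY n) mA.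
have [x Px] := prob_discrete_gt0 (@discrete_prefixX n) mWA PA.
(* Start from any coloring of positive probability and recolor the items with [a] one at a time. *)
pose xs s := foldr (fun i x => upd x i a) x s.
have -> : [tuple a | _ < n] = xs (enum 'I_n).
  apply: eq_from_tnth => k; rewrite tnth_mktuple.
  have : k \in enum 'I_n by rewrite mem_enum.
  elim: (enum 'I_n) => //= i s IH; rewrite inE tnth_upd.
  by case: eqVneq => //= _ /IH.
elim: (enum 'I_n) => //= i s IH.
by apply: prob_upd_gt0 => // w /wa.
Qed.

(** Some color has positive mass on [B]; giving it to all [n] items yields a positive product. *)
Lemma prob_rectangle_gt0 n (B : set (borel T)) : measurable B ->
  (0 < P (Y 0%N @^-1` B))%E ->
  (0 < P (prefix_of Y n @^-1` rectangle (fun=> B)))%E.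
Proof.
move=> mB PB.
have mWB m := measurable_preimageW (@measurable_prefixY m)
  (measurable_rectangle (fun _ : 'I_m => mB)).
have YB : Y 0%N @^-1` B = prefix_of Y 1 @^-1` rectangle (fun=> B).
  apply/seteqP; split => w /= h; first by move=> i; rewrite tnth_mktuple ord1.
  by have := h ord0; rewrite tnth_mktuple.
rewrite YB in PB.
have [x Px] := prob_discrete_gt0 (@discrete_prefixX 1) (mWB 1%N) PB.
move: Px; rewrite prob_joint// big_ord_recl big_ord0 mulr1 lte_fin => Px.
apply: (@lt_le_trans _ _
  (P (prefix_of X n @^-1` [set [tuple tnth x ord0 | _ < n]] `&`
  prefix_of Y n @^-1` rectangle (fun=> B)))).
  by rewrite prob_joint// lte_fin prodr_gt0// => i _; rewrite tnth_mktuple.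
apply: le_measure; rewrite ?inE; [|exact: mWB|exact: subIsetr].
by apply: measurableI; [exact: discrete_prefixX|exact: mWB].
Qed.

(** * Observations with a dominant color lacking a strict majority, and the Bayes rules there *)

Definition dominant (j a : 'I_J) : set (borel T) :=
  [set y | [/\ 0 < weight a y, forall l, l != j -> weight l y < weight j y &
              weight j y <= \sum_(l < J | l != j) weight l y]].

(** The maximum over [l != j] is positive exactly when some [a != j] has positive weight. Naming [a]
    supplies the color used for strictness. *)
Lemma ambiguousE j :
  ambiguous theta j = \bigcup_(a in [set a | a != j]) dominant j a.
Proof.
apply/seteqP; split => [y [m0 mj jS]|y [a aj [a0 lj jS]]].
  have lj l : l != j -> weight l y < weight j y.
    by move=> l_j; apply: le_lt_trans mj; exact: le_bigmax_cond.
  apply: contrapT => h; move: m0; apply/negP; rewrite -leNgt.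
  apply: bigmax_le => // l l_j; rewrite leNgt; apply/negP => l0.
  by apply: h; exists l.
split => //.
- apply: (lt_le_trans a0).
  by rewrite (@le_bigmax_cond _ _ _ _ _ _ (weight^~ y)).
- by apply: bigmax_lt => [|l l_j]; [exact: lt_trans a0 (lj _ aj)|exact: lj].
Qed.

(** For [l = j] this is part of [dominant]; for any other [l], the term of [j] alone already exceeds
    the weight of [l]. *)
Lemma dominant_le_sum j a y l : dominant j a y ->
  weight l y <= \sum_(b < J | b != l) weight b y.
Proof.
move=> [_ lj jS]; have [->//|l_j] := eqVneq l j.
rewrite (bigD1 j) 1?eq_sym//= (le_trans (ltW (lj l l_j)))// lerDl sumr_ge0//.
by move=> *; exact: weight_ge0.
Qed.

Lemma dominant_lt_sum j a y : a != j -> dominant j a y ->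
  weight a y < \sum_(b < J | b != a) weight b y.
Proof.
move=> aj [_ lj _]; rewrite (bigD1 j) 1?eq_sym//= ltr_wpDr ?lj// sumr_ge0//.
by move=> *; exact: weight_ge0.
Qed.

Lemma measurable_dominant j a : measurable (dominant j a).
Proof.
have mW := measurable_weight.
rewrite (_ : dominant j a = [set y | 0 < weight a y] `&`
  (\bigcap_(l in [set l | l != j]) [set y | weight l y < weight j y]) `&`
  [set y | weight j y <= \sum_(l < J | l != j) weight l y]); last first.
  by apply/seteqP; split => y [] /=; [move=> ? ? ?|move=> [? ?] ?]; split.
apply: measurableI; first apply: measurableI.
- by rewrite -[X in measurable X]setTI; exact: measurable_fun_ltr.
- apply: fin_bigcap_measurable => [|l _]; first exact: finite_finset.
  by rewrite -[X in measurable X]setTI; exact: measurable_fun_ltr.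
- rewrite -[X in measurable X]setTI; apply: measurable_fun_ler => //.
  under eq_fun do rewrite big_mkcond/=.
  by apply: measurable_sum => l /=; case: (l != j).
Qed.

(** If the constant answer [x] had a color [b != j] at item [i], answering [j] there would be
    correct with strictly larger probability on [A], since [j] outweighs [b] pointwise. *)
Lemma bayes_classifier_dominant n j a (A : set (n.-tuple (borel T)))
    (h : n.-tuple (borel T) -> n.-tuple 'I_J) (x : n.-tuple 'I_J) :
  bayes_classifier P X Y h -> measurable A ->
  A `<=` rectangle (fun=> dominant j a) ->
  (forall y, A y -> h y = x) -> (0 < P (prefix_of Y n @^-1` A))%E ->
  x = [tuple j | _ < n].
Proof.
move=> [mh hh] mA Adom hA PA.
have mW := @measurable_prefixY n.
have mWA := measurable_preimageW mW mA.
apply: eq_from_tnth => i; rewrite tnth_mktuple.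
apply/eqP/negPn/negP => xij; set b := tnth x i in xij *.
pose ev (c : 'I_J) (x : n.-tuple 'I_J) : R := (tnth x i == c)%:R.
(* Any coloring of positive probability serves, since the averaged difference is positive whatever
   the other colors. *)
have [x0 Px0] := prob_discrete_gt0 (@discrete_prefixX n) mWA PA.
have sumD x1 w :
    \sum_c (ev j (upd x1 i c) - ev b (upd x1 i c)) * weight c (Y i w) =
    weight j (Y i w) - weight b (Y i w).
  have sum1 c0 : \sum_c (c == c0)%:R * weight c (Y i w) = weight c0 (Y i w).
    rewrite (bigD1 c0)//= eqxx mul1r big1 ?addr0// => c.
    by move=> /negbTE ->; rewrite mul0r.
  under eq_bigr do rewrite /ev !tnth_updi mulrBl.
  by rewrite sumrB !sum1.
have : (0 < \int[P]_(w in prefix_of Y n @^-1` A)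
    (ev j (prefix_of X n w) - ev b (prefix_of X n w))%:E)%E.
  apply: (@integral_prefix_gt0 n (fun x => ev j x - ev b x) i x0) => // w.
    move=> /Adom/(_ i); rewrite tnth_mktuple => -[_ lj _] x1.
    by rewrite sumD subr_ge0 ltW// lj.
  move=> /Adom/(_ i); rewrite tnth_mktuple => -[_ lj _].
  by rewrite sumD subr_gt0 lj.
pose E1 := [set w | X i w = j].
pose E2 := [set w | X i w = tnth (h (prefix_of Y n w)) i].
have mE1 : measurable E1 by exact: discrete_X.
have mE2 : measurable E2.
  have := discrete_pair (@discrete_X i) (discrete_comp mW mh).
  move=> /discrete_preimage/(_ [set u | u.1 = tnth u.2 i]).
  by [].
(* The Bayes answer attains the maximal conditional probability, hence at least that of color
   [j]. *)
have le12 : {ae P, forall w, cond_exp P (prefix_of Y n) \1_E1 w <=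
    cond_exp P (prefix_of Y n) \1_E2 w}.
  apply: filterS (hh i) => w hw; rewrite -/(cond_prob P _ E2 _) hw.
  exact: (@le_bigmax _ _ _ _
    (fun c => cond_prob P (prefix_of Y n) [set w | X i w = c] w)).
have := is_cond_exp_le mW (cond_expP mW (integrable_indic P mE1))
  (cond_expP mW (integrable_indic P mE2)) mA le12.
have iev c : P.-integrable (prefix_of Y n @^-1` A)
    (fun w => (ev c (prefix_of X n w))%:E).
  exact: (discrete_integrable P (@discrete_prefixX n) (ev c) mWA).
rewrite (@eq_integral _ _ _ P _
  (fun w => (ev j (prefix_of X n w))%:E)); last first.
  move=> w _; rewrite indicE /ev tnth_mktuple.
  congr ((nat_of_bool _)%:R%:E).
  by apply/idP/eqP => [/set_mem//|Xw]; exact/mem_set.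
rewrite [X in (_ <= X)%E](@eq_integral _ _ _ P _
  (fun w => (ev b (prefix_of X n w))%:E)); last first.
  move=> w /set_mem Aw; rewrite indicE /ev tnth_mktuple.
  congr ((nat_of_bool _)%:R%:E).
  apply/idP/eqP => [/set_mem|Xw]; first by rewrite /E2/= hA.
  by apply/mem_set; rewrite /E2/= hA.
move=> le1; rewrite integralB_EFin; [|exact: mWA|exact: iev|exact: iev].
by rewrite sube_gt0 ltNge le1.
Qed.

(** Were the one-block answer given throughout [A], replacing it by the split would strictly lower
    the risk integrated over [A]. *)
Lemma bayes_clusterer_dominant n j a (A : set (n.-tuple (borel T)))
    (g : n.-tuple (borel T) -> {set {set 'I_n}}) :
  (1 < n)%N -> a != j ->
  bayes_clusterer P X Y g -> measurable A ->
  A `<=` rectangle (fun=> dominant j a) ->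
  (0 < P (prefix_of Y n @^-1` A))%E ->
  ~ (forall y, A y -> g y = [set [set: 'I_n]]%SET).
Proof.
move=> n1 aj [[mg pg] hg] mA Adom PA gA.
have mW := @measurable_prefixY n.
have mWA := measurable_preimageW mW mA.
pose i : 'I_n := Ordinal (ltnW n1).
(* The competitor replaces every one-block answer, also outside [A]; as a function of the answer of
   [g] alone it inherits measurability. *)
pose split1 B : {set {set 'I_n}} :=
  if B == [set [set: 'I_n]]%SET then split_off i else B.
have cg' : clusterer (split1 \o g).
  split; first by
    move=> B; exact: (discrete_preimage mg (split1 @^-1` [set B])).
  move=> y; rewrite /= /split1; case: ifP => // _.
  exact: split_off_partition.
have mX := @discrete_prefixX n.
have int_loss (g0 : n.-tuple (borel T) -> {set {set 'I_n}}) :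
    discrete_measurable_fun g0 -> P.-integrable setT
    (EFin \o (fun w => loss R (g0 (prefix_of Y n w)) (pi_n (prefix_of X n w)))).
  move=> mg0; have mgX := discrete_pair (discrete_comp mW mg0) mX.
  exact: (discrete_integrable P mgX (fun u => loss R u.1 (pi_n u.2))
    measurableT).
have := is_cond_exp_le mW (cond_expP mW (int_loss _ mg))
  (cond_expP mW (int_loss _ cg'.1)) mA (hg _ cg').
pose V B (x : n.-tuple 'I_J) : R := loss R B (pi_n x).
rewrite (@eq_integral _ _ _ P _
  (fun w => (V [set [set: 'I_n]]%SET (prefix_of X n w))%:E));
  last by move=> w /set_mem Aw; rewrite gA.
rewrite [X in (_ <= X)%E](@eq_integral _ _ _ P _
  (fun w => (V (split_off i) (prefix_of X n w))%:E)); last first.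
  by move=> w /set_mem Aw; rewrite /= /split1 gA// eqxx.
rewrite !(integral_discrete P mX _ mWA) lee_fin; apply/negP; rewrite -ltNge.
have : (0 < \int[P]_(w in prefix_of Y n @^-1` A)
    (@gain R n J i (prefix_of X n w))%:E)%E.
  apply: (@integral_prefix_gt0 n (@gain R n J i) i [tuple a | _ < n]) => //.
  - move=> w /Adom/(_ i); rewrite tnth_mktuple => dw x.
    apply: gain_sum_ge0 => // l; first exact: weight_ge0.
    exact: dominant_le_sum dw.
  - move=> w /Adom/(_ i); rewrite tnth_mktuple => dw.
    apply: gain_sum_gt0 => // [l|]; first exact: weight_ge0.
    exact: dominant_lt_sum dw.
  - apply: prob_const_gt0 => // w /Adom dw k.
    by have := dw k; rewrite tnth_mktuple => -[].
rewrite (integral_discrete P mX _ mWA) lte_fin => G0.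
(* The difference of the two integrated losses is [n^-1] times the integrated gain. *)
rewrite -subr_gt0 -sumrB.
rewrite (eq_bigr (fun x => n%:R^-1 * (gain R i x *
  fine (P (prefix_of X n @^-1` [set x] `&` prefix_of Y n @^-1` A))))).
  by rewrite -mulr_sumr mulr_gt0// invr_gt0 ltr0n ltnW.
move=> x _; rewrite -mulrBl mulrA; congr (_ * _).
by rewrite /V !lossE /gain mulrBr opprB [in LHS]addrC addrA subrK.
Qed.

End Model.

(** * Conclusion on an event where both rules are constant *)

Theorem theorem6 (R : realType) (J : nat) (hJ : (2 < J)%N)
  (T : ptopologicalType) (hT : polish_space R T)
  (L : {sigma_finite_measure set (borel T) -> \bar R})
  (theta : hmm_param R J T) (htheta : Theta_ind L theta)
  (d : measure_display) (Om : measurableType d) (P : probability Om R)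
  (X : nat -> Om -> 'I_J) (Y : nat -> Om -> borel T)
  (hXY : is_hmm L P X Y theta)
  (hpos : (0 < P (\bigcup_(j in [set: 'I_J]) (Y 0%N @^-1` ambiguous theta j)))%E)
  (n : nat) (hn : (2 <= n)%N)
  (g : n.-tuple (borel T) -> {set {set 'I_n}})
  (hg : bayes_clusterer P X Y g)
  (h : n.-tuple (borel T) -> n.-tuple 'I_J)
  (hh : bayes_classifier P X Y h) :
  (0 < P [set w | g (prefix_of Y n w) <> pi_n (h (prefix_of Y n w))])%E.
Proof.
have n0 : (0 < n)%N by exact: ltnW.
(* The ambiguous event is a finite union over pairs [(j, a)], so one piece has positive
   probability. *)
have [j [a [aj Pja]]] : exists j a, a != j /\
    (0 < P (Y 0%N @^-1` dominant theta j a))%E.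
  have mD u := measurable_preimageY hXY 0%N
    (measurable_dominant htheta u.1 u.2).
  have [|u uj Pu] := @prob_bigcup_gt0 _ _ _ P _ [set u | u.2 != u.1] _ mD.
    rewrite (_ : \bigcup_(u in _) _ =
      \bigcup_(j in [set: 'I_J]) (Y 0%N @^-1` ambiguous theta j))//.
    apply/seteqP; split => [w [[j a] aj ?]|w [j _]].
      by exists j => //; rewrite /= ambiguousE; exists a.
    by rewrite /= ambiguousE => -[a aj ?]; exists (j, a).
  by exists u.1, u.2.
have mdom := measurable_dominant htheta j a.
have mW := measurable_prefixY (n := n) hXY.
have [[[mg pg] _] [mh _]] := (hg, hh).
have mgh := discrete_pair mg mh.
have mrect := measurable_rectangle (fun _ : 'I_n => mdom).
have PE := prob_rectangle_gt0 htheta hXY n mdom Pja.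
(* The pair [(g, h)] takes finitely many values; one of them, [(B, x)], is taken with positive
   probability on the rectangle. *)
have [[B x] PA] := prob_discrete_gt0 (discrete_comp mW mgh)
  (measurable_preimageW mW mrect) PE.
pose A := (fun y => (g y, h y)) @^-1` [set (B, x)] `&`
  rectangle (fun _ : 'I_n => dominant theta j a).
have mA : measurable A by apply: measurableI => //; exact: mgh.
have xj : x = [tuple j | _ < n].
  apply: (bayes_classifier_dominant (a := a) htheta hXY hh mA _ _ PA).
    by move=> y [].
  by move=> y [[_ ->] _].
have Bset : B <> [set [set: 'I_n]]%SET.
  move=> BT; apply: (bayes_clusterer_dominant htheta hXY hn aj hg mA _ PA).
    by move=> y [].
  by move=> y [[-> _] _].
apply: lt_le_trans PA _; apply: le_measure; rewrite ?inE.
- exact: (measurable_preimageW mW mA).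
- have := discrete_preimage (discrete_comp mW mgh) [set u | u.1 <> pi_n u.2].
  by [].
- by move=> w [[gw hw] _]; rewrite /= gw hw xj pi_n_const.
Qed.
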